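(* Let $\mathbf{k}$ be a commutative unital ring, $\Omega$ a nonempty set and $X$ a set disjoint from $\Omega$. The quadruple $(H_{RT}(X,\Omega),m_{RT},\mathbf{1},\Delta_\epsilon)$ is an infinitesimal unitary bialgebra of weight zero.
   Context: An infinitesimal unitary bialgebra of weight $\lambda\in\mathbf{k}$ is a quadruple $(A,\mu,1,\Delta)$ with $(A,\mu,1)$ a unital associative algebra and $(A,\Delta)$ a coassociative coalgebra (possibly without counit) such that $\Delta(ab)=a\cdot\Delta(b)+\Delta(a)\cdot b+\lambda(a\otimes b)$ for all $a,b\in A$, where $a\cdot(b\otimes c)=ab\otimes c$ and $(b\otimes c)\cdot a=b\otimes ca$. A planar rooted tree is a finite rooted tree with a fixed embedding in the plane (so the children of each vertex are ordered from left to right). $\mathcal{T}(X,\Omega)$ is the set of planar rooted trees with vertices decorated by $X\sqcup\Omega$ such that all internal (non-leaf) vertices are decorated by elements of $\Omega$, while leaves may be decorated by any element of $X\sqcup\Omega$; the vertex of a one-vertex tree counts as a leaf. $\mathcal{F}(X,\Omega)$ is the free monoid on $\mathcal{T}(X,\Omega)$ under concatenation $m_{RT}$, with unit the empty tree $\mathbf{1}$. $H_{RT}(X,\Omega):=\mathbf{k}\mathcal{F}(X,\Omega)$ is the free $\mathbf{k}$-module on $\mathcal{F}(X,\Omega)$, with multiplication the linear extension of $m_{RT}$. For $\omega\in\Omega$, $B_\omega^+:H_{RT}(X,\Omega)\to H_{RT}(X,\Omega)$ is the linear map sending $\mathbf{1}$ to the one-vertex tree $\bullet_\omega$ and a forest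 to the tree obtained by grafting its trees (in order) on a new root decorated by $\omega$. The linear map $\Delta_\epsilon:H_{RT}(X,\Omega)\to H_{RT}(X,\Omega)\otimes H_{RT}(X,\Omega)$ is defined recursively by: $\Delta_\epsilon(\mathbf{1})=0$; $\Delta_\epsilon(\bullet_x)=\mathbf{1}\otimes\mathbf{1}$ for $x\in X$; $\Delta_\epsilon(B_\omega^+(\overline F))=\overline F\otimes\mathbf{1}+(\mathrm{id}\otimes B_\omega^+)\Delta_\epsilon(\overline F)$ for $\overline F\in\mathcal{F}(X,\Omega)$, $\omega\in\Omega$; and $\Delta_\epsilon(T_1\cdots T_m)=T_1\cdot\Delta_\epsilon(T_2\cdots T_m)+\Delta_\epsilon(T_1)\cdot(T_2\cdots T_m)$ for $m\geq2$, $T_i\in\mathcal{T}(X,\Omega)$. *)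

(* Defs.v *)
From HB Require Import structures.
From mathcomp Require Import all_boot all_algebra.
From mathcomp Require Import finmap boolp.
From mathcomp.multinomials Require Import monalg.

Set Implicit Arguments.
Unset Strict Implicit.
Unset Printing Implicit Defensive.

Import GRing.Theory.
Local Open Scope ring_scope.
Local Open Scope quotient_scope.

(* Finitely supported functions S -> k. The module structure that [malg]
   already carries requires 1 != 0 in k; it is rebuilt here, under a new name,
   so that the zero ring is allowed. *)
Definition freemod (k : pzRingType) (S : choiceType) : Type := {malg k[S]}.

HB.instance Definition _ k S := GRing.Zmodule.on (freemod k S).

Section FreeModule.
Context (k : pzRingType) (S : choiceType).
Local Notation F := (freemod k S).

Definition fm_scale (c : k) (g : F) : F :=
  [malg s in msupp g => c * g@_s]%fset.

Lemma fm_scaleE c (g : F) s : (fm_scale c g)@_s = c * g@_s.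
Proof. by rewrite mcoeffE; case: msuppP => // _; rewrite mulr0. Qed.

Fact fm_scaleA c d (g : F) : fm_scale c (fm_scale d g) = fm_scale (c * d) g.
Proof. by apply/malgP => s; rewrite !fm_scaleE mulrA. Qed.
Fact fm_scale1 : left_id 1 fm_scale.
Proof. by move=> g; apply/malgP => s; rewrite fm_scaleE mul1r. Qed.
Fact fm_scaleDr : right_distributive fm_scale +%R.
Proof.
by move=> c g h; apply/malgP => s; rewrite fm_scaleE !mcoeffD !fm_scaleE mulrDr.
Qed.
Fact fm_scaleDl (g : F) : {morph fm_scale^~ g : c d / c + d}.
Proof.
by move=> c d; apply/malgP => s; rewrite fm_scaleE mcoeffD !fm_scaleE mulrDl.
Qed.

HB.instance Definition _ := GRing.Zmodule_isLmodule.Build k F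
  fm_scaleA fm_scale1 fm_scaleDr fm_scaleDl.

Lemma freemodZE (c : k) (g : F) s : (c *: g)@_s = c * g@_s.
Proof. exact: fm_scaleE. Qed.

End FreeModule.

(* basis, linext, tens and tlift are locked: unification and rewriting may
   diverge if they can be unfolded. *)
HB.lock Definition basis (k : pzRingType) (S : choiceType) (s : S)
  : freemod k S := << 1 *g s >>.
Arguments basis {k S} s.

HB.lock Definition linext (k : pzRingType) (S : choiceType) (V : lmodType k)
    (f : S -> V) (g : freemod k S) : V :=
  \sum_(s <- msupp g) g@_s *: f s.
Arguments linext {k S V} f g.

Section FreeModuleTheory.
Context (k : pzRingType) (S : choiceType).
Local Notation F := (freemod k S).

Lemma freemodE (g : F) : g = \sum_(s <- msupp g) g@_s *: basis s.
Proof.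
rewrite basis.unlock [LHS]monalgE; apply: eq_bigr => s _.
by apply/malgP => t; rewrite freemodZE !mcoeffU mulrnAr mulr1.
Qed.

Section LinearExtension.
Context (V : lmodType k) (f : S -> V).

Lemma linextEw (d : {fset S}) (g : F) :
  (msupp g `<=` d)%fset -> linext f g = \sum_(s <- d) g@_s *: f s.
Proof.
move=> le; rewrite linext.unlock [LHS](big_fset_incl _ le) // => s _ /mcoeff_outdom ->.
by rewrite scale0r.
Qed.

Fact linext_is_linear : linear (linext f).
Proof.
move=> c g h; pose d := (msupp (c *: g + h) `|` msupp g `|` msupp h)%fset.
have le1 : (msupp (c *: g + h)%R `<=` d)%fset.
  by apply/fsubsetP => s; rewrite !inE => ->.
have le2 : (msupp g `<=` d)%fset.
  by apply/fsubsetP => s; rewrite !inE => ->; rewrite orbT.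
have le3 : (msupp h `<=` d)%fset.
  by apply/fsubsetP => s; rewrite !inE => ->; rewrite orbT.
rewrite (linextEw le1) (linextEw le2) (linextEw le3) scaler_sumr -big_split.
apply: eq_bigr => s _.
by rewrite /= mcoeffD freemodZE scalerDl scalerA.
Qed.

HB.instance Definition _ := GRing.isLinear.Build k F V _ (linext f)
  linext_is_linear.

Lemma linext_basis s : linext f (basis s) = f s.
Proof.
by rewrite basis.unlock (linextEw (@msuppU_le _ _ s 1)) big_seq_fset1 mcoeffUU scale1r.
Qed.

End LinearExtension.

Lemma freemod_ext (V : lmodType k) (f g : {linear F -> V}) :
  (forall s, f (basis s) = g (basis s)) -> f =1 g.
Proof.
move=> fg x; rewrite (freemodE x) !linear_sum.
by apply: eq_bigr => s _; rewrite !linearZ /= fg.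
Qed.

End FreeModuleTheory.

Definition bilinear_map (k : pzRingType) (A B V : lmodType k)
    (f : A -> B -> V) : Prop :=
  (forall a, linear (f a)) /\ (forall b, linear (f^~ b)).

Section Tensor.
Context (k : comPzRingType) (A B : lmodType k).
Local Notation F := (freemod k (A * B)%type).

Inductive tensor_relator : F -> Prop :=
| rel_addl a a' b :
    tensor_relator (basis (a + a', b) - basis (a, b) - basis (a', b))
| rel_addr a b b' :
    tensor_relator (basis (a, b + b') - basis (a, b) - basis (a, b'))
| rel_scalel c a b : tensor_relator (basis (c *: a, b) - c *: basis (a, b))
| rel_scaler c a b : tensor_relator (basis (a, c *: b) - c *: basis (a, b)).

Inductive tensor_relation : F -> Prop :=
| tensor_relation0 : tensor_relation 0
| tensor_relationP c r g : tensor_relator r -> tensor_relation g ->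
    tensor_relation (c *: r + g).

Lemma tensor_relation_lin c g h :
  tensor_relation g -> tensor_relation h -> tensor_relation (c *: g + h).
Proof.
move=> Rg Rh; elim: Rg => [|d r u Rr _ IH]; first by rewrite scaler0 add0r.
by rewrite scalerDr scalerA -addrA; constructor.
Qed.

Definition tensor_null : {pred F} := fun g => `[< tensor_relation g >].

Fact tensor_null_zmod : zmod_closed tensor_null.
Proof.
split=> [|g h]; first exact/asboolP/tensor_relation0.
move=> /asboolP Rg /asboolP Rh; apply/asboolP.
rewrite addrC -[- h]scaleN1r; exact: tensor_relation_lin.
Qed.

HB.instance Definition _ := GRing.isZmodClosed.Build F tensor_null
  tensor_null_zmod.

Definition tensor : Type := Quotient.quot tensor_null.

HB.instance Definition _ := GRing.Zmodule.on tensor.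
HB.instance Definition _ := EqQuotient.on tensor.

Local Notation pi := (\pi_tensor : F -> tensor).

Lemma tensor_eqP (g h : F) : pi g = pi h <-> tensor_relation (g - h).
Proof.
split=> [/eqP|R]; first by rewrite -Quotient.idealrBE => /asboolP.
by apply/eqP; rewrite -Quotient.idealrBE; apply/asboolP.
Qed.

Fact tensor_piD : {morph pi : g h / g + h}.
Proof. exact: raddfD. Qed.

Definition tensor_scale (c : k) (x : tensor) : tensor := pi (c *: repr x).

Lemma tensor_scale_pi c g : tensor_scale c (pi g) = pi (c *: g).
Proof.
apply/tensor_eqP; rewrite -scalerBr -[c *: _]addr0.
apply: tensor_relation_lin; last exact: tensor_relation0.
by apply/tensor_eqP; rewrite reprK.
Qed.

Fact tensor_scaleA c d x :
  tensor_scale c (tensor_scale d x) = tensor_scale (c * d) x.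
Proof. by elim/quotW: x => g; rewrite (tensor_scale_pi d) !tensor_scale_pi scalerA. Qed.
Fact tensor_scale1 : left_id 1 tensor_scale.
Proof. by elim/quotW => g; rewrite tensor_scale_pi scale1r. Qed.
Fact tensor_scaleDr : right_distributive tensor_scale +%R.
Proof.
move=> c; elim/quotW => g; elim/quotW => h.
by rewrite -tensor_piD !tensor_scale_pi scalerDr tensor_piD.
Qed.
Fact tensor_scaleDl x : {morph tensor_scale^~ x : c d / c + d}.
Proof.
elim/quotW: x => g c d.
by rewrite !tensor_scale_pi scalerDl tensor_piD.
Qed.

HB.instance Definition _ := GRing.Zmodule_isLmodule.Build k tensor
  tensor_scaleA tensor_scale1 tensor_scaleDr tensor_scaleDl.

Fact tensor_pi_linear : linear pi.
Proof. by move=> c g h; rewrite tensor_piD -tensor_scale_pi. Qed.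

End Tensor.

Notation "A ⊗ B" := (tensor A B)
  (at level 40, left associativity) : type_scope.

HB.lock Definition tens (k : comPzRingType) (A B : lmodType k)
    (a : A) (b : B) : (A ⊗ B)%type := \pi_(A ⊗ B)%type (basis (a, b)).
Arguments tens {k A B} a b.

Notation "a ⊗ b" := (tens a b)
  (at level 40, left associativity) : ring_scope.

(* Meaningful when f is bilinear, in which case it is the linear map of the
   universal property (lemmas below). *)
HB.lock Definition tlift (k : comPzRingType) (A B V : lmodType k)
    (f : A -> B -> V) (x : (A ⊗ B)%type) : V :=
  linext (fun p : (A * B)%type => f p.1 p.2) (repr x).
Arguments tlift {k A B V} f x.

Section TensorTheory.
Context (k : comPzRingType) (A B : lmodType k).
Local Notation F := (freemod k (A * B)%type).
Local Notation tensor := (A ⊗ B)%type.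
Local Notation pi := (\pi_tensor : F -> tensor).

Lemma tens_bilinear : bilinear_map (@tens k A B).
Proof.
have rel r : tensor_relator r -> tensor_relation r.
  move=> Rr; rewrite -[r]scale1r -[_ *: _]addr0.
  by apply: tensor_relationP => //; apply: tensor_relation0.
have addl a a' b : tens (a + a') b = tens a b + tens a' b.
  rewrite tens.unlock -tensor_piD; apply/tensor_eqP; rewrite opprD addrA.
  exact/rel/rel_addl.
have addr a b b' : tens a (b + b') = tens a b + tens a b'.
  rewrite tens.unlock -tensor_piD; apply/tensor_eqP; rewrite opprD addrA.
  exact/rel/rel_addr.
have scalel c a b : tens (c *: a) b = c *: tens a b.
  by rewrite tens.unlock [RHS]tensor_scale_pi; apply/tensor_eqP/rel/rel_scalel.
have scaler c a b : tens a (c *: b) = c *: tens a b.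
  by rewrite tens.unlock [RHS]tensor_scale_pi; apply/tensor_eqP/rel/rel_scaler.
by split=> [a c b b'|b c a a'] /=; rewrite ?addr ?addl ?scaler ?scalel.
Qed.

Section Lift.
Context (V : lmodType k) (f : A -> B -> V) (f_bilin : bilinear_map f).
Local Notation L := (linext (fun p : (A * B)%type => f p.1 p.2)).

Lemma linext_relation g : tensor_relation g -> L g = 0.
Proof.
have [fr fl] := f_bilin.
elim=> [|c r {}g Rr _ IH]; first exact: linear0.
rewrite linearP /= IH addr0; suff -> : L r = 0 by rewrite scaler0.
case: {c g IH} r / Rr => [a a' b|a b b'|c a b|c a b];
  rewrite !linearB ?linearZ /= !linext_basis /=.
- by rewrite -[a]scale1r fl !scale1r addrAC addrK subrr.
- by rewrite -[b]scale1r fr !scale1r addrAC addrK subrr.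
- have f0 : f 0 b = 0 by have := fl b (-1) 0 0; rewrite /= scaler0 addr0 scaleN1r addNr.
  by rewrite -[c *: a]addr0 fl f0 addr0 scalerN subrr.
- have f0 : f a 0 = 0 by have := fr a (-1) 0 0; rewrite /= scaler0 addr0 scaleN1r addNr.
  by rewrite -[c *: b]addr0 fr f0 addr0 scalerN subrr.
Qed.

Lemma tlift_pi g : tlift f (pi g) = L g.
Proof.
apply/eqP; rewrite -subr_eq0 tlift.unlock -linearB; apply/eqP/linext_relation.
by apply/tensor_eqP; rewrite reprK.
Qed.

Lemma tlift_tens a b : tlift f (tens a b) = f a b.
Proof. by rewrite tens.unlock tlift_pi linext_basis. Qed.

Lemma tlift_linear : linear (tlift f).
Proof.
move=> c; elim/quotW => g; elim/quotW => h.
by rewrite -tensor_pi_linear !tlift_pi linearP.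
Qed.

End Lift.

Lemma tensor_ext (V : lmodType k) (f g : tensor -> V) :
  linear f -> linear g -> (forall a b, f (tens a b) = g (tens a b)) -> f =1 g.
Proof.
move=> fl gl fg; elim/quotW => x.
pose fL := HB.pack_for {linear F -> V} (f \o pi)
  (GRing.isLinear.Build _ _ _ _ (f \o pi)
    (fun c u v => etrans (congr1 f (tensor_pi_linear c u v)) (fl c _ _))).
pose gL := HB.pack_for {linear F -> V} (g \o pi)
  (GRing.isLinear.Build _ _ _ _ (g \o pi)
    (fun c u v => etrans (congr1 g (tensor_pi_linear c u v)) (gl c _ _))).
apply: (@freemod_ext _ _ _ fL gL _ x) => -[a b].
by have := fg a b; rewrite tens.unlock.
Qed.

End TensorTheory.

Definition tmap (k : comPzRingType) (A A' B B' : lmodType k)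
    (f : A -> A') (g : B -> B') : (A ⊗ B)%type -> (A' ⊗ B')%type :=
  tlift (fun a b => f a ⊗ g b).

Definition tassoc (k : comPzRingType) (A B C : lmodType k) :
    ((A ⊗ B) ⊗ C)%type -> (A ⊗ (B ⊗ C))%type :=
  tlift (fun x c => tlift (fun a b => a ⊗ (b ⊗ c)) x).

Section TensorMaps.
Context (k : comPzRingType).

Section Map.
Context (A A' B B' : lmodType k) (f : A -> A') (g : B -> B').
Hypotheses (f_lin : linear f) (g_lin : linear g).

Fact tmap_bilinear : bilinear_map (fun a b => f a ⊗ g b).
Proof.
have [tr tl] := tens_bilinear A' B'.
split=> [a c b b'|b c a a'] /=; first by rewrite g_lin tr.
by rewrite f_lin tl.
Qed.

Lemma tmap_tens a b : tmap f g (a ⊗ b) = f a ⊗ g b.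
Proof. exact: tlift_tens tmap_bilinear _ _. Qed.

Lemma tmap_linear : linear (tmap f g).
Proof. exact: tlift_linear tmap_bilinear. Qed.

End Map.

Section Assoc.
Context (A B C : lmodType k).

Let assoc_inner c : bilinear_map (fun (a : A) (b : B) => a ⊗ (b ⊗ (c : C))).
Proof.
have [tr tl] := tens_bilinear A (B ⊗ C)%type.
have [tr' tl'] := tens_bilinear B C.
by split=> [a d b b'|b d a a'] /=; rewrite ?tl' ?tr ?tl.
Qed.

Fact tassoc_bilinear : bilinear_map
  (fun (x : (A ⊗ B)%type) (c : C) => tlift (fun a b => a ⊗ (b ⊗ c)) x).
Proof.
have [tr tl] := tens_bilinear A (B ⊗ C)%type.
have [tr' tl'] := tens_bilinear B C.
split=> [x d c c'|c]; last exact: tlift_linear (assoc_inner c).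
have lin (g g' : (A ⊗ B)%type -> (A ⊗ (B ⊗ C))%type) : linear g -> linear g' ->
    linear (fun y => d *: g y + g' y).
  move=> gl gl' e u v.
  by rewrite gl gl' !scalerDr !scalerA (mulrC d e) addrACA.
apply: (tensor_ext (tlift_linear (assoc_inner _))
  (lin _ _ (tlift_linear (assoc_inner c)) (tlift_linear (assoc_inner c')))).
by move=> a b; rewrite !(tlift_tens (assoc_inner _)) tr' tr.
Qed.

Lemma tassoc_tens (a : A) (b : B) (c : C) :
  tassoc ((a ⊗ b) ⊗ c) = a ⊗ (b ⊗ c).
Proof. by rewrite [LHS](tlift_tens tassoc_bilinear) (tlift_tens (assoc_inner c)). Qed.

Lemma tassoc_linear : linear (@tassoc _ A B C).
Proof. exact: tlift_linear tassoc_bilinear. Qed.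

End Assoc.
End TensorMaps.

Section InfinitesimalUnitaryBialgebra.
Context (k : comPzRingType) (A : lmodType k).
Implicit Types (mu : A -> A -> A) (Delta : A -> (A ⊗ A)%type).

Record unital_algebra mu (one : A) : Prop := {
  mu_bilinear : bilinear_map mu;
  mu_assoc : associative mu;
  mu_one_l : left_id one mu;
  mu_one_r : right_id one mu
}.

Record coassociative_coalgebra Delta : Prop := {
  Delta_linear : linear Delta;
  Delta_coassoc :
    forall a, tassoc (tmap Delta id (Delta a)) = tmap id Delta (Delta a)
}.

(* a . (b ⊗ c) = ab ⊗ c  and  (b ⊗ c) . a = b ⊗ ca *)
Definition lact mu (a : A) : (A ⊗ A)%type -> (A ⊗ A)%type := tmap (mu a) id.
Definition ract mu (x : (A ⊗ A)%type) (a : A) : (A ⊗ A)%type :=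
  tmap id (mu^~ a) x.

Lemma lact_tens mu a b c :
  linear (mu a) -> lact mu a (b ⊗ c) = mu a b ⊗ c.
Proof. by move=> lin; apply: tmap_tens. Qed.

Lemma ract_tens mu a b c :
  linear (mu^~ a) -> ract mu (b ⊗ c) a = b ⊗ mu c a.
Proof. by move=> lin; apply: (@tmap_tens _ _ _ _ _ id (mu^~ a)). Qed.

Record infinitesimal_unitary_bialgebra (lambda : k) mu (one : A) Delta
    : Prop := {
  iub_algebra : unital_algebra mu one;
  iub_coalgebra : coassociative_coalgebra Delta;
  iub_compatible : forall a b : A,
    Delta (mu a b) =
      lact mu a (Delta b) + ract mu (Delta a) b + lambda *: (a ⊗ b)
}.

End InfinitesimalUnitaryBialgebra.

(* A vertex decorated by X has no children; a vertex decorated by Omega has an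
   ordered sequence of children, and is a leaf when this sequence is empty. *)
Inductive tree (X Omega : Type) : Type :=
| Leaf of X
| Node of Omega & seq (tree X Omega).

Arguments Leaf {X Omega} x.
Arguments Node {X Omega} w ts.

Section TreeChoice.
Context (X Omega : choiceType).
Local Notation T := (tree X Omega).

Fixpoint tree_encode (t : T) : GenTree.tree (X + Omega) :=
  match t with
  | Leaf x => GenTree.Leaf (inl x)
  | Node w ts => GenTree.Node 0 (GenTree.Leaf (inr w) :: map tree_encode ts)
  end.

Fixpoint tree_decode (g : GenTree.tree (X + Omega)) : option T :=
  match g with
  | GenTree.Leaf (inl x) => Some (Leaf x)
  | GenTree.Node _ (GenTree.Leaf (inr w) :: gs) =>
      Some (Node w (pmap tree_decode gs))
  | _ => None
  end.

Fact tree_encodeK : pcancel tree_encode tree_decode.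
Proof.
rewrite /pcancel; fix IH 1; case=> [x|w ts] //=; congr (Some (Node w _)).
by elim: ts => //= t ts IHts; rewrite IH /= IHts.
Qed.

HB.instance Definition _ := Choice.copy T (pcan_type tree_encodeK).

End TreeChoice.

Definition forest (X Omega : Type) : Type := seq (tree X Omega).

HB.instance Definition _ (X Omega : choiceType) :=
  Choice.on (forest X Omega).

Section HRT.
Context (k : comPzRingType) (X Omega : choiceType).

Definition HRT : Type := freemod k (forest X Omega).
HB.instance Definition _ := GRing.Lmodule.on HRT.

Definition fbasis (F : forest X Omega) : HRT := basis F.
Definition one_RT : HRT := fbasis [::].

Definition m_RT (u v : HRT) : HRT :=
  linext (fun F => linext (fun G => fbasis (F ++ G)) v) u.

Definition Bplus (w : Omega) : HRT -> HRT :=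
  linext (fun F => fbasis [:: Node w F]).

Section ForestStep.
Context (D : tree X Omega -> (HRT ⊗ HRT)%type).

Fixpoint Delta_seq (F : forest X Omega) : (HRT ⊗ HRT)%type :=
  match F with
  | [::] => 0
  | [:: t] => D t
  | t :: F' =>
      lact m_RT (fbasis [:: t]) (Delta_seq F') + ract m_RT (D t) (fbasis F')
  end.

End ForestStep.

Fixpoint Delta_tree (t : tree X Omega) : (HRT ⊗ HRT)%type :=
  match t with
  | Leaf _ => one_RT ⊗ one_RT
  | Node w F => fbasis F ⊗ one_RT + tmap id (Bplus w) (Delta_seq Delta_tree F)
  end.

Definition Delta_eps : HRT -> (HRT ⊗ HRT)%type :=
  linext (Delta_seq Delta_tree).

Lemma Delta_eps_linear : linear Delta_eps.
Proof. exact: linext_is_linear. Qed.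

Lemma Delta_eps_fbasis F : Delta_eps (fbasis F) = Delta_seq Delta_tree F.
Proof. exact: linext_basis. Qed.

Lemma Delta_eps_one : Delta_eps one_RT = 0.
Proof. exact: linext_basis. Qed.

Lemma Delta_eps_leaf x :
  Delta_eps (fbasis [:: Leaf x]) = one_RT ⊗ one_RT.
Proof. exact: linext_basis. Qed.

Lemma Bplus_fbasis w F : Bplus w (fbasis F) = fbasis [:: Node w F].
Proof. exact: linext_basis. Qed.

Lemma Delta_eps_Bplus w F :
  Delta_eps (Bplus w (fbasis F)) =
    fbasis F ⊗ one_RT + tmap id (Bplus w) (Delta_eps (fbasis F)).
Proof. by rewrite Bplus_fbasis !Delta_eps_fbasis. Qed.

Lemma Delta_eps_cons t F : F != [::] ->
  Delta_eps (fbasis (t :: F)) =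
    lact m_RT (fbasis [:: t]) (Delta_eps (fbasis F))
    + ract m_RT (Delta_eps (fbasis [:: t])) (fbasis F).
Proof. by case: F => // t' F _; rewrite !Delta_eps_fbasis. Qed.

Lemma m_RT_fbasis F G : m_RT (fbasis F) (fbasis G) = fbasis (F ++ G).
Proof. by rewrite /m_RT !linext_basis. Qed.

End HRT.

(* Main.v *)
Require Import Defs.
From HB Require Import structures.
From mathcomp Require Import all_boot all_algebra.

Set Implicit Arguments.
Unset Strict Implicit.
Unset Printing Implicit Defensive.

Import GRing.Theory.
Local Open Scope ring_scope.

(** The coproduct is determined by two rules. On products it is a derivation
    of the algebra [H] of forests with values in the bimodule [H ⊗ H]; and
    grafting is a cocycle: [Delta (B u) = u ⊗ 1 + (id ⊗ B) (Delta u)].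

    The derivation rule on two arbitrary forests comes from its case of a tree
    followed by a forest, by induction on the length of the first forest and
    the bimodule laws of [H ⊗ H] (lemma [Delta_seq_cat]); bilinearity then
    gives it for all elements of [H], which is the compatibility condition in
    weight zero.

    Coassociativity is proved by induction on forests, since the elements that
    satisfy it are closed under every operation that builds a forest:
    - it holds at [1], where [Delta] vanishes, and hence at a leaf decorated
      by [X], whose coproduct is [1 ⊗ 1];
    - it passes from [u] to [B u] ([coassoc_at_cocycle]): in Sweedler notation
      both iterated coproducts of [B u] are [Delta u ⊗ 1] plus the image under
      [id ⊗ id ⊗ B] of the corresponding iterated coproduct of [u];
    - it passes from [a] and [b] to [ab] ([coassoc_at_mul]): the iterated
      coproducts of [ab] are those of [a] acted on by [b], those of [b] acted
      on by [a], and the mixed term [a1 ⊗ a2 b1 ⊗ b2], which is common to both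
      sides. *)

(** * Linear maps and tensors *)

Section LinearMaps.
Context (k : comPzRingType).
Implicit Types A B C U V W : lmodType k.

Lemma linear_idfun A : linear (@id A).
Proof. by []. Qed.

Lemma linear_compose U V W (g : V -> W) (f : U -> V) :
  linear g -> linear f -> linear (fun x => g (f x)).
Proof. by move=> gl fl c x y; rewrite fl gl. Qed.

Lemma linear_plus U V (f g : U -> V) :
  linear f -> linear g -> linear (fun x => f x + g x).
Proof. by move=> fl gl c x y; rewrite fl gl scalerDr addrACA. Qed.

Lemma linear_add U V (f : U -> V) : linear f -> {morph f : x y / x + y}.
Proof. by move=> fl x y; have := fl 1 x y; rewrite !scale1r. Qed.

Lemma linear_zero U V (f : U -> V) : linear f -> f 0 = 0.
Proof.
by move=> fl; have := fl (-1) 0 0; rewrite scaler0 addr0 scaleN1r addNr.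
Qed.

Lemma freemod_linear_ext (S : choiceType) V (f g : freemod k S -> V) :
  linear f -> linear g -> (forall s, f (basis s) = g (basis s)) -> f =1 g.
Proof.
move=> fl gl fg.
pose fL := HB.pack_for {linear freemod k S -> V} f
  (GRing.isLinear.Build _ _ _ _ f fl).
pose gL := HB.pack_for {linear freemod k S -> V} g
  (GRing.isLinear.Build _ _ _ _ g gl).
exact: (@freemod_ext _ _ _ fL gL).
Qed.

Lemma tens_linear_r A B (a : A) : linear (fun b : B => a ⊗ b).
Proof. exact: (tens_bilinear A B).1. Qed.

Lemma tens_linear_l A B (b : B) : linear (fun a : A => a ⊗ b).
Proof. exact: (tens_bilinear A B).2. Qed.

Lemma tmap_comp A A' A'' B B' B'' (f' : A' -> A'') (f : A -> A')
    (g' : B' -> B'') (g : B -> B') :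
  linear f -> linear f' -> linear g -> linear g' ->
  forall x, tmap f' g' (tmap f g x)
          = tmap (fun a => f' (f a)) (fun b => g' (g b)) x.
Proof.
move=> fl fl' gl gl'.
have fc := linear_compose fl' fl; have gc := linear_compose gl' gl.
apply: tensor_ext.
- apply: linear_compose; exact: tmap_linear.
- exact: tmap_linear.
- by move=> a b; rewrite !tmap_tens.
Qed.

(** The maps [u ↦ lact u x] and [u ↦ ract x u] of the bimodule [A ⊗ A] are
    instances of this lemma and the next: it suffices to compare the two sides
    of linearity in [u] on pure tensors, where tensoring is bilinear. *)
Lemma tmap_linear_fun_r A B U V (g : U -> B -> V) :
  (forall u, linear (g u)) -> (forall b, linear (g^~ b)) ->
  forall x : (A ⊗ B)%type, linear (fun u => tmap (@id A) (g u) x).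
Proof.
move=> gr gl x c u v; have il := linear_idfun.
move: x; apply: tensor_ext.
- exact: tmap_linear.
- apply: linear_plus; last exact: tmap_linear.
  move=> d x y; rewrite tmap_linear // scalerDr !scalerA.
  by rewrite (mulrC c d).
- by move=> a b; rewrite !tmap_tens // gl tens_linear_r.
Qed.

Lemma tmap_linear_fun_l A B U V (f : U -> A -> V) :
  (forall u, linear (f u)) -> (forall a, linear (f^~ a)) ->
  forall x : (A ⊗ B)%type, linear (fun u => tmap (f u) (@id B) x).
Proof.
move=> fr fl x c u v; have il := linear_idfun.
move: x; apply: tensor_ext.
- exact: tmap_linear.
- apply: linear_plus; last exact: tmap_linear.
  move=> d x y; rewrite tmap_linear // scalerDr !scalerA.
  by rewrite (mulrC c d).
- by move=> a b; rewrite !tmap_tens // fl tens_linear_l.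
Qed.

(** Naturality of the associator in its last factor. *)
Lemma tassoc_natural_r A B C C' (g : C -> C') : linear g ->
  forall x : ((A ⊗ B) ⊗ C)%type,
    tassoc (tmap id g x) = tmap id (tmap id g) (tassoc x).
Proof.
move=> gl; have il := linear_idfun.
have tl : linear (tmap (@id B) g) by exact: tmap_linear.
apply: tensor_ext.
- apply: linear_compose; [exact: tassoc_linear | exact: tmap_linear].
- apply: linear_compose; [exact: tmap_linear | exact: tassoc_linear].
move=> y c; rewrite tmap_tens //; move: y; apply: tensor_ext.
- apply: linear_compose; [exact: tassoc_linear | exact: tens_linear_l].
- apply: linear_compose; first exact: tmap_linear.
  by apply: linear_compose; [exact: tassoc_linear | exact: tens_linear_l].
- by move=> a b; rewrite !tassoc_tens !tmap_tens.
Qed.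

Lemma tassoc_natural_l A A' B C (f : A -> A') : linear f ->
  forall x : ((A ⊗ B) ⊗ C)%type,
    tassoc (tmap (tmap f id) id x) = tmap f id (tassoc x).
Proof.
move=> fl; have il := linear_idfun.
have tl : linear (tmap f (@id B)) by exact: tmap_linear.
apply: tensor_ext.
- apply: linear_compose; [exact: tassoc_linear | exact: tmap_linear].
- apply: linear_compose; [exact: tmap_linear | exact: tassoc_linear].
move=> y c; rewrite tmap_tens //; move: y; apply: tensor_ext.
- apply: linear_compose; first exact: tassoc_linear.
  by apply: (linear_compose (g := fun z => z ⊗ c)); [exact: tens_linear_l | exact: tl].
- apply: linear_compose; first exact: tmap_linear.
  by apply: linear_compose; [exact: tassoc_linear | exact: tens_linear_l].
- by move=> a b; rewrite tmap_tens // !tassoc_tens tmap_tens.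
Qed.

Lemma tassoc_tens_r A B C (c : C) :
  forall x : (A ⊗ B)%type, tassoc (x ⊗ c) = tmap id (fun b => b ⊗ c) x.
Proof.
have il := linear_idfun; have tl := @tens_linear_l B C c.
apply: tensor_ext.
- apply: linear_compose; [exact: tassoc_linear | exact: tens_linear_l].
- exact: tmap_linear.
- by move=> a b; rewrite tassoc_tens tmap_tens.
Qed.

End LinearMaps.

(** * The bimodule of tensors over an algebra *)

Section Bimodule.
Context (k : comPzRingType) (A : lmodType k) (mu : A -> A -> A) (one : A).
Context (alg : unital_algebra mu one).

Lemma mul_linear_r a : linear (mu a).
Proof. exact: (mu_bilinear alg).1. Qed.

Lemma mul_linear_l b : linear (mu^~ b).
Proof. exact: (mu_bilinear alg).2. Qed.

Local Notation ml := mul_linear_r.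
Local Notation mr := mul_linear_l.

Lemma lact_linear a : linear (lact mu a).
Proof. by apply: tmap_linear; [exact: ml | exact: linear_idfun]. Qed.

Lemma ract_linear b : linear (fun x => ract mu x b).
Proof. by apply: tmap_linear; [exact: linear_idfun | exact: mr]. Qed.

Lemma lact_linear_l x : linear (fun a => lact mu a x).
Proof. by apply: tmap_linear_fun_l; [exact: ml | exact: mr]. Qed.

Lemma ract_linear_r x : linear (ract mu x).
Proof. by apply: (tmap_linear_fun_r (g := fun b => mu^~ b)); [exact: mr | exact: ml]. Qed.

Lemma lact_mul a b x : lact mu (mu a b) x = lact mu a (lact mu b x).
Proof.
move: x; apply: tensor_ext; first exact: lact_linear.
  by apply: linear_compose; exact: lact_linear.
by move=> c d; rewrite !lact_tens ?(mu_assoc alg) //; exact: ml.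
Qed.

Lemma ract_mul a b x : ract mu x (mu a b) = ract mu (ract mu x a) b.
Proof.
move: x; apply: tensor_ext; first exact: ract_linear.
  by apply: (linear_compose (g := fun y => ract mu y b)); exact: ract_linear.
by move=> c d; rewrite !ract_tens ?(mu_assoc alg) //; exact: mr.
Qed.

Lemma lact_ract a b x : lact mu a (ract mu x b) = ract mu (lact mu a x) b.
Proof.
have [mla mrb] := (ml a, mr b); move: x; apply: tensor_ext.
- by apply: linear_compose; [exact: lact_linear | exact: ract_linear].
- apply: (linear_compose (g := fun y => ract mu y b)); [exact: ract_linear | exact: lact_linear].
- by move=> c d; rewrite ract_tens // !lact_tens // ract_tens.
Qed.

Lemma lact_one x : lact mu one x = x.
Proof.
move: x; apply: tensor_ext; [exact: lact_linear | exact: linear_idfun |].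
by move=> c d; rewrite lact_tens ?(mu_one_l alg) //; exact: ml.
Qed.

Lemma ract_one x : ract mu x one = x.
Proof.
move: x; apply: tensor_ext; [exact: ract_linear | exact: linear_idfun |].
by move=> c d; rewrite ract_tens ?(mu_one_r alg) //; exact: mr.
Qed.

(** The mixed term of the coproduct of a product: with [x = a1 ⊗ a2] and
    [y = b1 ⊗ b2], both sides are [a1 ⊗ a2 b1 ⊗ b2]. *)
Lemma tassoc_ract_lact (x y : (A ⊗ A)%type) :
  tassoc (tmap (ract mu x) id y) = tmap id (fun c => lact mu c y) x.
Proof.
have il := @linear_idfun k.
move: y; apply: tensor_ext.
- apply: linear_compose; first exact: tassoc_linear.
  by apply: tmap_linear => //; exact: ract_linear_r.
- apply: (tmap_linear_fun_r (g := fun y c => lact mu c y)).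
    exact: lact_linear_l.
  exact: lact_linear.
move=> b1 b2; rewrite tmap_tens //; last exact: ract_linear_r.
have ll := lact_linear_l (b1 ⊗ b2).
move: x; apply: tensor_ext.
- apply: linear_compose; first exact: tassoc_linear.
  apply: (linear_compose (g := fun a => a ⊗ b2)); first exact: tens_linear_l.
  exact: ract_linear.
- exact: tmap_linear.
move=> a1 a2; rewrite ract_tens ?tassoc_tens ?tmap_tens //; last exact: mr.
by rewrite lact_tens //; exact: ml.
Qed.

End Bimodule.

(** * Closure properties of coassociativity *)

Section Coassociativity.
Context (k : comPzRingType) (A : lmodType k) (Delta : A -> (A ⊗ A)%type).
Context (Dl : linear Delta).

(** Coassociativity is treated elementwise because it is propagated by
    induction along the construction of the elements. *)
Definition coassoc_at (a : A) : Prop :=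
  tassoc (tmap Delta id (Delta a)) = tmap id Delta (Delta a).

Let D1l : linear (tmap Delta (@id A)).
Proof. exact: tmap_linear. Qed.

Let D2l : linear (tmap (@id A) Delta).
Proof. exact: tmap_linear. Qed.

Let D1al : linear (fun x => tassoc (tmap Delta (@id A) x)).
Proof. by apply: linear_compose; [exact: tassoc_linear | exact: D1l]. Qed.

Lemma coassoc_at_eq0 a : Delta a = 0 -> coassoc_at a.
Proof.
by rewrite /coassoc_at => ->; rewrite (linear_zero D1al) (linear_zero D2l).
Qed.

Lemma coassoc_at_tens_one a one :
  Delta one = 0 -> Delta a = one ⊗ one -> coassoc_at a.
Proof.
move=> D1 Da; rewrite /coassoc_at Da !tmap_tens // D1.
rewrite (linear_zero (@tens_linear_l _ _ _ one)).
rewrite (linear_zero (@tens_linear_r _ _ _ one)).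
exact: linear_zero (@tassoc_linear _ _ _ _).
Qed.

(** Write [Delta u = u1 ⊗ u2], so that [Delta (B u) = u ⊗ 1 + u1 ⊗ B u2]. On
    the left [Delta u ⊗ 1] comes from [u ⊗ 1]. On the right [u ⊗ 1] is
    killed, as [Delta 1 = 0], and [Delta u ⊗ 1 = u1 ⊗ (u2 ⊗ 1)] comes from
    the expansion of [Delta (B u2)]. What remains on each side is the image
    under [id ⊗ id ⊗ B] of that side at [u]. *)
Lemma coassoc_at_cocycle (one : A) (B : A -> A) : linear B -> Delta one = 0 ->
  (forall u, Delta (B u) = u ⊗ one + tmap id B (Delta u)) ->
  forall u, coassoc_at u -> coassoc_at (B u).
Proof.
move=> Bl D1 DB u Cu; have il := @linear_idfun k; rewrite /coassoc_at DB.
have tBl : linear (tmap (@id A) B) by exact: tmap_linear.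
have tol := @tens_linear_l k A A one.
rewrite (linear_add D1al) (linear_add D2l) !tmap_tens //.
rewrite D1 (linear_zero (@tens_linear_r _ _ _ u)) add0r tassoc_tens_r.
have swap x : tmap Delta id (tmap id B x) = tmap id B (tmap Delta id x).
  by rewrite !tmap_comp.
rewrite swap tassoc_natural_r // Cu !tmap_comp //.
have expand (x : (A ⊗ A)%type) : tmap id (fun b => Delta (B b)) x =
    tmap id (fun b => b ⊗ one) x + tmap id (fun b => tmap id B (Delta b)) x.
  have tBDl := linear_compose tBl Dl; have DBl := linear_compose Dl Bl.
  move: x; apply: tensor_ext; first exact: tmap_linear.
    by apply: linear_plus; exact: tmap_linear.
  by move=> a b; rewrite !tmap_tens // DB (linear_add (@tens_linear_r _ _ _ a)).
by rewrite expand.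
Qed.

(** Applying [Delta] to the left factors of [a b1 ⊗ b2 + a1 ⊗ a2 b] yields
    the mixed term from its first summand, and applying it to the right
    factors yields the same term from the second one. *)
Lemma coassoc_at_mul (mu : A -> A -> A) (one : A) : unital_algebra mu one ->
  (forall a b, Delta (mu a b) = lact mu a (Delta b) + ract mu (Delta a) b) ->
  forall a b, coassoc_at a -> coassoc_at b -> coassoc_at (mu a b).
Proof.
move=> alg der a b Ca Cb; have il := @linear_idfun k.
have mla := mul_linear_r alg a; have mrb := mul_linear_l alg b.
have lal := lact_linear alg a; have rbl := ract_linear alg b.
have lDl := lact_linear_l alg (Delta b); have rDl := ract_linear_r alg (Delta a).
rewrite /coassoc_at der (linear_add D1al) (linear_add D2l).
have left_l x : tassoc (tmap Delta id (lact mu a x)) =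
    tmap (mu a) id (tassoc (tmap Delta id x))
    + tassoc (tmap (ract mu (Delta a)) id x).
  rewrite -(tassoc_natural_l mla).
  rewrite -(linear_add (@tassoc_linear k A A A)).
  congr tassoc; rewrite /lact !tmap_comp //.
  have cl := linear_compose lal Dl; have dl := linear_compose Dl mla.
  move: x; apply: tensor_ext; first exact: tmap_linear.
    by apply: linear_plus; exact: tmap_linear.
  by move=> c d; rewrite !tmap_tens // der (linear_add (@tens_linear_l _ _ _ d)).
have right_l x : tmap id Delta (lact mu a x) = tmap (mu a) id (tmap id Delta x).
  by rewrite /lact !tmap_comp.
have left_r x : tassoc (tmap Delta id (ract mu x b)) =
    tmap id (fun y => ract mu y b) (tassoc (tmap Delta id x)).
  by rewrite -tassoc_natural_r // /ract !tmap_comp.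
have right_r x : tmap id Delta (ract mu x b) =
    tmap id (fun c => lact mu c (Delta b)) x
    + tmap id (fun y => ract mu y b) (tmap id Delta x).
  rewrite /ract !tmap_comp //.
  have cl := linear_compose rbl Dl; have dl := linear_compose Dl mrb.
  move: x; apply: tensor_ext; first exact: tmap_linear.
    by apply: linear_plus; exact: tmap_linear.
  by move=> c d; rewrite !tmap_tens // der (linear_add (@tens_linear_r _ _ _ c)).
by rewrite left_l right_l left_r right_r (tassoc_ract_lact alg) Ca Cb -addrA.
Qed.

End Coassociativity.

(** * The algebra of forests and its coproduct *)

(** Forests are built from the empty one by grafting and concatenation, so one
    predicate on forests is enough for the induction on nested trees. *)
Lemma forest_graft_ind (X Omega : Type) (P : forest X Omega -> Prop) :
  P [::] -> (forall x, P [:: Leaf x]) ->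
  (forall w F, P F -> P [:: Node w F]) ->
  (forall t F, P [:: t] -> P F -> P (t :: F)) ->
  forall F, P F.
Proof.
move=> P0 Px Pw Pc.
have Pt : forall t, P [:: t].
  fix IH 1; case=> [x|w F]; first exact: Px.
  by apply: Pw; elim: F => [|t F IHF] //; exact: Pc.
by elim=> [|t F IHF] //; exact: Pc.
Qed.

Section Forests.
Context (k : comPzRingType) (X Omega : choiceType).
Local Notation H := (HRT k X Omega).
Local Notation mul := (@m_RT k X Omega).
Local Notation one := (@one_RT k X Omega).
Local Notation fb := (@fbasis k X Omega).
Local Notation Delta := (@Delta_eps k X Omega).
Implicit Types F G : forest X Omega.

Lemma HRT_ext (V : lmodType k) (f g : H -> V) :
  linear f -> linear g -> (forall F, f (fb F) = g (fb F)) -> f =1 g.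
Proof. exact: freemod_linear_ext. Qed.

Lemma m_RT_linear_l v : linear (mul^~ v).
Proof. exact: linext_is_linear. Qed.

Lemma m_RT_linear_r u : linear (mul u).
Proof.
move=> c v v'; move: u; apply: HRT_ext; first exact: m_RT_linear_l.
  apply: linear_plus; last exact: m_RT_linear_l.
  move=> d x y; rewrite m_RT_linear_l scalerDr !scalerA.
  by rewrite (mulrC c d).
by move=> F; rewrite /m_RT !linext_basis; exact: linext_is_linear.
Qed.

Lemma m_RT_unital_algebra : unital_algebra mul one.
Proof.
split; first by split; [exact: m_RT_linear_r | exact: m_RT_linear_l].
- move=> u v w; move: u; apply: HRT_ext; first exact: m_RT_linear_l.
    apply: (linear_compose (g := mul^~ w)); exact: m_RT_linear_l.
  move=> F; move: v; apply: HRT_ext.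
    apply: linear_compose; [exact: m_RT_linear_r | exact: m_RT_linear_l].
    apply: (linear_compose (g := mul^~ w)); [exact: m_RT_linear_l | exact: m_RT_linear_r].
  move=> G; move: w; apply: HRT_ext; last first.
    by move=> K; rewrite !m_RT_fbasis catA.
  exact: m_RT_linear_r.
  by apply: linear_compose; exact: m_RT_linear_r.
- apply: HRT_ext; [exact: m_RT_linear_r | exact: linear_idfun |].
  by move=> F; rewrite m_RT_fbasis.
- apply: HRT_ext; [exact: m_RT_linear_l | exact: linear_idfun |].
  by move=> F; rewrite m_RT_fbasis cats0.
Qed.

Local Notation alg := m_RT_unital_algebra.

(** A forest of one tree has its own clause in the recursion, but it obeys the
    general one, because the coproduct of the empty forest is zero. *)
Lemma Delta_seq_cons (D : tree X Omega -> (H ⊗ H)%type) t F :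
  Delta_seq D (t :: F) =
    lact mul (fb [:: t]) (Delta_seq D F) + ract mul (D t) (fb F).
Proof.
case: F => [|t' F] //=.
by rewrite (linear_zero (lact_linear alg _)) (ract_one alg) add0r.
Qed.

(** The recursive clause splits off one tree at a time; the bimodule laws of
    [H ⊗ H] turn it into a rule for cutting a forest anywhere. *)
Lemma Delta_seq_cat (D : tree X Omega -> (H ⊗ H)%type) F G :
  Delta_seq D (F ++ G) =
    lact mul (fb F) (Delta_seq D G) + ract mul (Delta_seq D F) (fb G).
Proof.
elim: F => [|t F IH].
  by rewrite (lact_one alg) (linear_zero (ract_linear alg (fb G))) addr0.
rewrite cat_cons !Delta_seq_cons IH (linear_add (lact_linear alg _)).
rewrite (linear_add (ract_linear alg (fb G))) -(lact_mul alg) m_RT_fbasis.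
by rewrite (lact_ract alg) -(ract_mul alg) m_RT_fbasis addrA.
Qed.

Lemma Delta_eps_derivation u v :
  Delta (mul u v) = lact mul u (Delta v) + ract mul (Delta u) v.
Proof.
have Dl := @Delta_eps_linear k X Omega.
move: u; apply: HRT_ext.
- apply: linear_compose; [exact: Dl | exact: m_RT_linear_l].
- apply: linear_plus; first exact: (lact_linear_l alg).
  apply: (linear_compose (g := fun x => ract mul x v)); [exact: (ract_linear alg) | exact: Dl].
move=> F; move: v; apply: HRT_ext.
- apply: linear_compose; [exact: Dl | exact: m_RT_linear_r].
- apply: linear_plus; last exact: (ract_linear_r alg).
  apply: linear_compose; [exact: (lact_linear alg) | exact: Dl].
by move=> G; rewrite m_RT_fbasis !Delta_eps_fbasis Delta_seq_cat.
Qed.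

Lemma Bplus_linear w : linear (@Bplus k X Omega w).
Proof. exact: linext_is_linear. Qed.

Lemma Delta_eps_cocycle w u :
  Delta (Bplus w u) = u ⊗ one + tmap id (Bplus w) (Delta u).
Proof.
have Dl := @Delta_eps_linear k X Omega; have Bl := Bplus_linear w.
move: u; apply: HRT_ext; [exact: linear_compose | | exact: Delta_eps_Bplus].
apply: linear_plus; first exact: tens_linear_l.
by apply: linear_compose => //; apply: tmap_linear.
Qed.

Lemma Delta_eps_coassoc u : coassoc_at Delta u.
Proof.
have Dl := @Delta_eps_linear k X Omega; have il := @linear_idfun k.
move: u; apply: HRT_ext.
- apply: linear_compose; first exact: tassoc_linear.
  by apply: linear_compose => //; apply: tmap_linear.
- by apply: linear_compose => //; apply: tmap_linear.
have D1 := @Delta_eps_one k X Omega.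
elim/forest_graft_ind => [|x|w F IH|t F IHt IH].
- exact: coassoc_at_eq0 Dl _ D1.
- exact: coassoc_at_tens_one Dl _ _ D1 (Delta_eps_leaf k _ x).
- rewrite -Bplus_fbasis.
  exact: (coassoc_at_cocycle Dl (Bplus_linear w) D1 (Delta_eps_cocycle w)) IH.
- rewrite -[t :: F]/([:: t] ++ F) -m_RT_fbasis.
  exact: (coassoc_at_mul Dl alg Delta_eps_derivation).
Qed.

End Forests.

Theorem theorem4p15 (k : comPzRingType) (X Omega : choiceType)
    (Omega_nonempty : inhabited Omega) :
  @infinitesimal_unitary_bialgebra k (HRT k X Omega) 0
    (@m_RT k X Omega) (@one_RT k X Omega) (@Delta_eps k X Omega).
Proof.
split; first exact: m_RT_unital_algebra.
- by split; [exact: Delta_eps_linear | exact: Delta_eps_coassoc].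
- by move=> a b; rewrite scale0r addr0 Delta_eps_derivation.
Qed.
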